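(* Let $m\ge 1$ and let $\|\cdot\|$ be any norm on $\mathbb{R}^m$. There exists a constant $C_1>0$, independent of $A$ (so depending only on $m$ and the norm), such that for every $A\in\mathbb{R}^{m\times m}$ and all matrices $P,Q,R\in\mathbb{R}^{m\times m}$ output by the arbitrary-norm rank-revealing QR algorithm (described in the context) applied to $A$ and $\|\cdot\|$, the following hold: (1) $AP=QR$; (2) $R$ is upper triangular with nonincreasing diagonal entries, i.e. $R(1,1)\ge R(2,2)\ge\cdots\ge R(m,m)$; (3) $\displaystyle\max_{\|x\|=1}\|Qx\|\le C_1$, the maximum being over $x\in\mathbb{R}^m$ with $\|x\|=1$.
   Context: Arbitrary-norm rank-revealing QR algorithm. Input: a matrix $A=(A_1,\dots,A_m)\in\mathbb{R}^{m\times m}$ (columns $A_i$) and a norm $\|\cdot\|$ on $\mathbb{R}^m$. Output: $P=(P_1,\dots,P_m)$, $Q=(Q_1,\dots,Q_m)$, $R$, all in $\mathbb{R}^{m\times m}$. Here $e_k$ denotes the $k$th column of the identity matrix, and $Q^j=(Q_1,\dots,Q_j)\in\mathbb{R}^{m\times j}$ denotes the first $j$ columns of $Q$. Base step: choose $k\in\operatorname{argmax}_{i}\|A_i\|$ and set $P_1=e_k$, $Q_1=A_k/\|A_k\|$, $R(1,1)=\|A_k\|$. Inductive step, for $j=1,\dots,m-1$: choose $$k_j\in\operatorname{argmax}_{1\le i\le m}\ \min_{c\in\mathbb{R}^j}\|A_i-Q^jc\|,\qquad c_j\in\operatorname{argmin}_{c\in\mathbb{R}^j}\|A_{k_j}-Q^jc\|,$$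 and set $\gamma_j=\|A_{k_j}-Q^jc_j\|$, $P_{j+1}=e_{k_j}$, $Q_{j+1}=\gamma_j^{-1}(A_{k_j}-Q^jc_j)$ (so $Q^{j+1}=(Q^j,Q_{j+1})$), $R(1:j,\,j+1)=c_j$ (the first $j$ entries of column $j+1$ of $R$), and $R(j+1,j+1)=\gamma_j$. All other entries of $R$ are $0$. Whenever an argmax or argmin is not unique, any choice is allowed. ''$P,Q,R$ are output by the algorithm'' means that they arise from some sequence of such choices for which all the divisions are defined, i.e. $\|A_k\|\neq 0$ and $\gamma_j\ne0$ for all $1\le j\le m-1$. *)

(* Defs.v *)
From mathcomp Require Import all_boot all_order all_algebra.
From mathcomp Require Import classical_sets reals.

Set Implicit Arguments.
Unset Strict Implicit.
Unset Printing Implicit Defensive.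

Import Order.TTheory GRing.Theory Num.Theory.
Local Open Scope classical_set_scope.
Local Open Scope ring_scope.

Record is_norm (K : realType) (m : nat) (N : 'cV[K]_m -> K) : Prop := IsNorm {
  is_norm_ge0 : forall x, 0 <= N x;
  is_norm_eq0 : forall x, N x = 0 -> x = 0;
  is_normZ : forall (a : K) x, N (a *: x) = `|a| * N x;
  is_norm_triangle : forall x y, N (x + y) <= N x + N y
}.

Definition is_max (K : realType) (S : set K) (d : K) : Prop := S d /\ ubound S d.
Definition is_min (K : realType) (S : set K) (d : K) : Prop := S d /\ lbound S d.

Definition is_argmax (K : realType) (T : Type) (f : T -> K) (t : T) : Prop :=
  forall s, f s <= f t.
Definition is_argmin (K : realType) (T : Type) (f : T -> K) (t : T) : Prop :=
  forall s, f t <= f s.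

(* Inclusion of the first j indices into 'I_m, for j : 'I_m. *)
Definition lead_ord (m : nat) (j : 'I_m) : 'I_j -> 'I_m :=
  widen_ord (ltnW (ltn_ord j)).

(* With 0-based indices, the columns of Q strictly before column j : 'I_m are
   the first j columns, that is Q^j in the 1-based notation. *)
Definition lead_cols (K : realType) (m : nat) (Q : 'M[K]_m) (j : 'I_m) :
    'M[K]_(m, j) :=
  colsub (lead_ord (j := j)) Q.

Definition rrqr_base (K : realType) (m : nat) (N : 'cV[K]_m -> K)
    (A P Q R : 'M[K]_m) (j : 'I_m) : Prop :=
  exists k : 'I_m,
    is_argmax (fun i => N (col i A)) k /\
    [/\ N (col k A) != 0,
        col j P = delta_mx k 0,
        col j Q = (N (col k A))^-1 *: col k A &
        R j j = N (col k A)].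

(* The step producing column j > 0 (column j+1 in 1-based notation).  The value
   dist i is min_c N (A_i - Q^j c); these minima always exist, because N is a
   norm on a finite-dimensional space. *)
Definition rrqr_step (K : realType) (m : nat) (N : 'cV[K]_m -> K)
    (A P Q R : 'M[K]_m) (j : 'I_m) : Prop :=
  let resid (i : 'I_m) (c : 'cV[K]_j) := col i A - lead_cols Q j *m c in
  exists (dist : 'I_m -> K) (k : 'I_m) (c : 'cV[K]_j),
    [/\ forall i, is_min [set N (resid i c') | c' in [set: 'cV[K]_j]] (dist i),
        is_argmax dist k &
        is_argmin (fun c' => N (resid k c')) c] /\
    let gamma := N (resid k c) in
    [/\ gamma != 0,
        col j P = delta_mx k 0,
        col j Q = gamma^-1 *: resid k c,
        forall l : 'I_j, R (lead_ord l) j = c l 0 &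
        R j j = gamma].

Record rrqr_output (K : realType) (m : nat) (N : 'cV[K]_m -> K)
    (A P Q R : 'M[K]_m) : Prop := RrqrOutput {
  rrqr_first : forall j : 'I_m, j = 0 :> nat -> rrqr_base N A P Q R j;
  rrqr_next : forall j : 'I_m, (0 < j)%N -> rrqr_step N A P Q R j;
  rrqr_other : forall i j : 'I_m, (j < i)%N -> R i j = 0
}.

(* Main.v *)
Require Import Defs.
From mathcomp Require Import all_boot all_order all_algebra.
From mathcomp Require Import classical_sets reals.
From mathcomp Require Import boolp topology normedtype derive.

Import Order.TTheory GRing.Theory Num.Theory.
Import numFieldNormedType.Exports.
Local Open Scope classical_set_scope.
Local Open Scope ring_scope.

(* Every column of Q is normalised, so N (Q x) <= sum_i |x_i|, and the
   equivalence of norms on K^m bounds the right-hand side by C_1 N x with C_1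
   depending on m and N only.  The diagonal entry R(j,j) is the largest distance
   from a column of A to the span of the first j columns of Q; these spans
   increase with j, so the distances decrease. *)

Lemma is_norm0 (K : realType) (m : nat) (N : 'cV[K]_m -> K) :
  is_norm N -> N 0 = 0.
Proof. by move=> hN; rewrite -(scale0r 0) (is_normZ hN) normr0 mul0r. Qed.

Lemma is_norm_dist_le (K : realType) (m : nat) (N : 'cV[K]_m -> K) (x y : 'cV[K]_m) :
  is_norm N -> `|N x - N y| <= N (x - y).
Proof.
move=> hN; rewrite ler_norml lerBlDr lerNl opprB lerBlDr; apply/andP; split.
  have -> : N (x - y) = N (y - x).
    by rewrite -opprB -scaleN1r (is_normZ hN) normrN1 mul1r.
  by apply: le_trans (is_norm_triangle hN _ _); rewrite subrK.
by apply: le_trans (is_norm_triangle hN _ _); rewrite subrK.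
Qed.

Lemma is_norm_sum (K : realType) (m : nat) (N : 'cV[K]_m -> K) (n : nat)
    (F : 'I_n -> 'cV[K]_m) :
  is_norm N -> N (\sum_i F i) <= \sum_i N (F i).
Proof.
move=> hN; elim/big_ind2: _ => [|x a y b xa yb|//]; first by rewrite is_norm0.
exact: le_trans (is_norm_triangle hN _ _) (lerD xa yb).
Qed.

Lemma normr_entry_le (K : realType) (m n : nat) (A : 'M[K]_(m, n)) i j :
  `|A i j| <= `|A|.
Proof.
by rewrite [leRHS]/Num.norm /= mx_normrE; apply/bigmax_geP; right; exists (i, j).
Qed.

(** Expand the product over the columns of [Q] and bound each coefficient by the max norm [|u|].
    This gives both the Lipschitz constant for continuity and the final bound on [Q]. Vectors are
    transposed rows because the compactness argument is run on row vectors. *)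
Lemma is_norm_mulmx_le (K : realType) (m n : nat) (N : 'cV[K]_m -> K)
    (Q : 'M[K]_(m, n)) (u : 'rV[K]_n) :
  is_norm N -> N (Q *m u^T) <= (\sum_i N (col i Q)) * `|u|.
Proof.
move=> hN.
have -> : Q *m u^T = \sum_i u 0 i *: col i Q.
  apply/colP => a; rewrite !mxE summxE; apply: eq_bigr => i _.
  by rewrite !mxE mulrC.
apply: le_trans (is_norm_sum _ _ _ _ _ hN) _; rewrite mulr_suml.
apply: ler_sum => i _; rewrite (is_normZ hN) mulrC.
by rewrite ler_wpM2l ?(is_norm_ge0 hN) ?normr_entry_le.
Qed.

Lemma is_norm_mulmx_continuous (K : realType) (m n : nat) (N : 'cV[K]_m -> K)
    (Q : 'M[K]_(m, n)) :
  is_norm N -> continuous (fun u : 'rV[K]_n => N (Q *m u^T)).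
Proof.
(* The [+ 1] keeps the Lipschitz constant [L] positive even when every column vanishes, so that
   [e / L] is a valid radius. *)
move=> hN u; set L := \sum_i N (col i Q) + 1.
have L0 : 0 < L.
  by rewrite ltr_wpDl// sumr_ge0// => i _; rewrite (is_norm_ge0 hN).
apply/(cvgrPdist_lt (FF := nbhs_filter u)) => e e0; apply/nbhs_ballP; exists (e / L) => /=.
  by rewrite divr_gt0.
move=> v; rewrite -ball_normE /= ltr_pdivlMr// => uv.
apply: le_lt_trans uv; apply: le_trans (is_norm_dist_le _ _ _ _ _ hN) _.
rewrite -mulmxBr -linearB /=; apply: le_trans (is_norm_mulmx_le _ _ _ _ _ _ hN) _.
by rewrite mulrC ler_wpM2l// lerDl.
Qed.

Lemma is_norm_trmx_continuous (K : realType) (m : nat) (N : 'cV[K]_m -> K) :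
  is_norm N -> continuous (fun u : 'rV[K]_m => N u^T).
Proof.
move=> hN; have := is_norm_mulmx_continuous _ _ _ N 1%:M hN.
by under eq_fun do rewrite mul1mx.
Qed.

Lemma is_norm_const_mx1_gt0 (K : realType) (m : nat) (N : 'cV[K]_m -> K) :
  (1 <= m)%N -> is_norm N -> 0 < N (const_mx 1).
Proof.
move=> hm hN; rewrite lt_def (is_norm_ge0 hN) andbT.
apply/eqP => /(is_norm_eq0 hN) /colP /(_ (Ordinal hm)) /eqP.
by rewrite !mxE oner_eq0.
Qed.

(** By continuity [N] attains its minimum on the compact max-norm unit sphere, and this minimum is
    positive. [D] is its inverse, and homogeneity extends the bound from the sphere to all
    vectors. *)
Lemma mx_norm_le_is_norm (K : realType) (m : nat) (N : 'cV[K]_m -> K) :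
  (1 <= m)%N -> is_norm N ->
  exists D : K, 0 < D /\ forall u : 'rV[K]_m, `|u| <= D * N u^T.
Proof.
move=> hm hN; pose S := [set u : 'rV[K]_m | `|u| = 1].
have S0 : S !=set0.
  pose w : 'rV[K]_m := const_mx 1.
  have w0 : `|w| != 0.
    rewrite normr_eq0; apply/eqP => /rowP /(_ (Ordinal hm)) /eqP.
    by rewrite !mxE oner_eq0.
  by exists (`|w|^-1 *: w); rewrite /S /= normrZ normfV normr_id mulVf.
have cS : compact S.
  apply: bounded_closed_compact.
    by exists 1; split=> [|M M1 u /= ->]; rewrite ?num_real ?ltW.
  apply: (preimage_closed (f := fun u : 'rV[K]_m => `|u|) (D := [set x | x = 1])).
    by move=> u _; exact: (@norm_continuous _ _ u).
  exact: closed_eq.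
have [c cS1 cmin] := compact_EVT_min S0 cS
  (continuous_subspaceT (is_norm_trmx_continuous _ _ _ hN)).
have c1 : `|c| = 1 by move: cS1; rewrite inE.
have Nc0 : 0 < N c^T.
  rewrite lt_def (is_norm_ge0 hN) andbT; apply/eqP => /(is_norm_eq0 hN) /eqP.
  by rewrite trmx_eq0 -(normr_eq0 c) c1 oner_eq0.
exists (N c^T)^-1; split; first by rewrite invr_gt0.
move=> u; rewrite ler_pdivlMl//.
have [->|u0] := eqVneq u 0; first by rewrite normr0 mulr0 (is_norm_ge0 hN).
have nu0 : 0 < `|u| by rewrite normr_gt0.
have /cmin : `|u|^-1 *: u \in S.
  by rewrite inE /S /= normrZ normfV normr_id mulVf ?gt_eqF.
rewrite linearZ /= (is_normZ hN) normfV normr_id ler_pdivlMl//.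
by rewrite mulrC.
Qed.

(** The unit sphere of [N] is closed by continuity and bounded by the comparison with the max norm,
    hence compact. *)
Lemma opnorm_attained (K : realType) (m : nat) (N : 'cV[K]_m -> K) (Q : 'M[K]_m) :
  (1 <= m)%N -> is_norm N ->
  exists M : K, is_max [set N (Q *m x) | x in [set x : 'cV[K]_m | N x = 1]] M.
Proof.
move=> hm hN; pose S := [set u : 'rV[K]_m | N u^T = 1].
have S0 : S !=set0.
  pose w : 'cV[K]_m := const_mx 1.
  have w0 : 0 < N w by exact: is_norm_const_mx1_gt0.
  exists ((N w)^-1 *: w)^T; rewrite /S /= trmxK (is_normZ hN).
  by rewrite normfV gtr0_norm// mulVf// gt_eqF.
have [D [D0 hD]] := mx_norm_le_is_norm _ _ _ hm hN.
have cS : compact S.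
  apply: bounded_closed_compact.
    exists D; split=> [|M DM u /= uS]; first exact: num_real.
    by rewrite (le_trans (hD u))// uS mulr1 ltW.
  apply: (preimage_closed (f := fun u : 'rV[K]_m => N u^T) (D := [set x | x = 1])).
    by move=> u _; exact: is_norm_trmx_continuous.
  exact: closed_eq.
have [c cS1 cmax] := compact_EVT_max S0 cS
  (continuous_subspaceT (is_norm_mulmx_continuous _ _ _ _ Q hN)).
exists (N (Q *m c^T)); split.
  by exists c^T => //; move: cS1; rewrite inE.
move=> _ [x /= x1 <-]; rewrite -[x]trmxK; apply: cmax.
by rewrite inE /S /= trmxK.
Qed.

Lemma lead_cols_le (K : realType) (m : nat) (Q : 'M[K]_m) (i j : 'I_m)
    (c : 'cV[K]_i) :
  (i <= j)%N -> exists d : 'cV[K]_j, lead_cols Q i *m c = lead_cols Q j *m d.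
Proof.
(* The submatrix of the identity is the inclusion of the first [i] coordinates: the witness is [c]
   padded with zeros. *)
move=> ij; exists (colsub (widen_ord ij) 1%:M *m c).
rewrite mulmxA mulmx_colsub mulmx1; congr (_ *m c).
by apply/matrixP => a l; rewrite !mxE; congr (Q a _); apply: val_inj.
Qed.

(** Treats the base and inductive steps uniformly. The last two clauses encode that [R j j] is the
    largest distance from a column of [A] to the span of the earlier columns of [Q], attained at
    column [k]. *)
Lemma rrqr_column (K : realType) (m : nat) (N : 'cV[K]_m -> K)
    (A P Q R : 'M[K]_m) (j : 'I_m) :
  is_norm N -> rrqr_output N A P Q R ->
  N (col j Q) = 1 /\
  exists (k : 'I_m) (c : 'cV[K]_j),
    [/\ col j P = delta_mx k 0,
        col k A = lead_cols Q j *m c + R j j *: col j Q,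
        forall l, R (lead_ord l) j = c l 0,
        forall d : 'cV[K]_j, R j j <= N (col k A - lead_cols Q j *m d) &
        forall i, exists d : 'cV[K]_j, N (col i A - lead_cols Q j *m d) <= R j j].
Proof.
move=> hN [base step _].
have normalized x : N x != 0 -> N ((N x)^-1 *: x) = 1.
  move=> x0; rewrite (is_normZ hN) normfV ger0_norm ?(is_norm_ge0 hN)//.
  by rewrite mulVf.
have [j0|j0] := posnP j.
  have [k [kmax [Nk0 Pj Qj Rj]]] := base j j0.
  (* At index 0 there are no earlier columns, so the span is zero and every residual is the column
     itself. *)
  have lead0 (d : 'cV[K]_j) : lead_cols Q j *m d = 0.
    apply/colP => a; rewrite !mxE big1// => -[l lj].
    by exfalso; rewrite j0 in lj.
  split; first by rewrite Qj normalized.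
  exists k, 0; split => //.
  - by rewrite lead0 add0r Rj Qj scalerA mulfV// scale1r.
  - by case=> l lj; exfalso; rewrite j0 in lj.
  - by move=> d; rewrite lead0 subr0 Rj.
  - by move=> i; exists 0; rewrite lead0 subr0 Rj.
have [dist [k [c [[dmin dmax cmin] [g0 Pj Qj Rc Rj]]]]] := step j j0.
split; first by rewrite Qj normalized.
exists k, c; split => //.
- by rewrite Rj Qj scalerA mulfV// scale1r addrC subrK.
- by move=> d; rewrite Rj; exact: cmin.
- move=> i; have [[d _ Nd] _] := dmin i; exists d.
  (* Here [dist i <= dist k], and [dist k] is at most the residual norm at [c], which is [R j j]. *)
  rewrite Nd Rj; apply: le_trans (dmax i) _.
  by have [_ lbk] := dmin k; apply: lbk; exists c.
Qed.

Theorem theorem2p1 (K : realType) (m : nat) (hm : (1 <= m)%N)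
    (N : 'cV[K]_m -> K) (hN : is_norm N) :
  exists C1 : K, 0 < C1 /\
    forall A P Q R : 'M[K]_m, rrqr_output N A P Q R ->
      [/\ A *m P = Q *m R,
          (forall i j : 'I_m, (j < i)%N -> R i j = 0) /\
          (forall i j : 'I_m, (i <= j)%N -> R j j <= R i i) &
          exists M : K,
            is_max [set N (Q *m x) | x in [set x : 'cV[K]_m | N x = 1]] M /\
            M <= C1].
Proof.
have [D [D0 hD]] := mx_norm_le_is_norm _ _ _ hm hN.
(* [m] is the sum of the norms of the unit columns of [Q]; [D] bounds the max norm on the unit
   sphere of [N]. *)
exists (m%:R * D); split; first by rewrite mulr_gt0// ltr0n.
move=> A P Q R out; split.
- apply/matrixP => a j.
  have [_ [k [c [Pj Ak Rc _ _]]]] := rrqr_column _ _ _ _ _ _ _ j hN out.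
  have -> : (A *m P) a j = col k A a 0.
    by rewrite colE -Pj !mxE; apply: eq_bigr => l _; rewrite !mxE.
  (* Split row times column of [Q *m R] at [j]: indices below [j] give the projection part [c],
     index [j] the residual, and larger ones vanish. *)
  rewrite Ak !mxE (bigID (fun l : 'I_m => (l < j)%N)) /=; congr (_ + _).
    rewrite (big_ord_narrow (ltnW (ltn_ord j))); apply: eq_bigr => l _.
    by rewrite -Rc !mxE.
  rewrite (bigD1 j) ?ltnn//= big1 ?addr0 1?mulrC// => l /andP[].
  rewrite -leqNgt leq_eqVlt => /orP[/eqP/val_inj ->|jl _]; first by rewrite eqxx.
  by rewrite (rrqr_other out) ?mulr0.
- split=> [|i j ij]; first exact: rrqr_other out.
  (* Follow the column [k] chosen at step [j]: at the earlier step [i] it was already within [R i i]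
     of a smaller span, and that approximant is still available at step [j]. *)
  have [_ [k [_ [_ _ _ Rle _]]]] := rrqr_column _ _ _ _ _ _ _ j hN out.
  have [_ [_ [_ [_ _ _ _ /(_ k)[c Rge]]]]] := rrqr_column _ _ _ _ _ _ _ i hN out.
  have [d cd] := lead_cols_le _ _ Q _ _ c ij.
  by apply: le_trans (Rle d) _; rewrite -cd.
- have [M Mmax] := opnorm_attained _ _ _ Q hm hN; exists M; split=> //.
  have [[x /= x1 <-] _] := Mmax.
  rewrite -[x]trmxK; apply: le_trans (is_norm_mulmx_le _ _ _ _ _ _ hN) _.
  rewrite (eq_bigr (fun=> 1)); last first.
    by move=> j _; have [] := rrqr_column _ _ _ _ _ _ _ j hN out.
  rewrite sumr_const card_ord ler_wpM2l// (le_trans (hD _))//.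
  by rewrite trmxK x1 mulr1.
Qed.
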